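(* Let $K$ be a field, let $R=K[x,y]/(xy,\,x^2-y^3)$, and let $\mathfrak{m}=(x,y)R$ be the ideal of $R$ generated by the residue classes of $x$ and $y$. Let $M=R/(y)$ and $N=R/(x-y)$, regarded as $R$-modules. Then $\mathfrak{m}^2M=0$, $\mathfrak{m}^2N=0$, and $\operatorname{Tor}_i^R(M,N)=0$ for all $i\geq 1$, whereas $\mathfrak{m}^3\neq 0$.
   Context: The residue classes in $R$ of the polynomial variables $x,y$ are again denoted by $x,y$; $(y)$ and $(x-y)$ denote the ideals of $R$ generated by these residue classes. *)

(* Defs.v *)
From HB Require Import structures.
From mathcomp Require Import all_boot all_order all_algebra.
From mathcomp Require Import ring_quotient generic_quotient.
From mathcomp Require Import boolp.
From mathcomp Require Import finmap monalg mpoly.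

Set Implicit Arguments.
Unset Strict Implicit.
Unset Printing Implicit Defensive.

Import GRing.Theory.
Local Open Scope ring_scope.
Local Open Scope quotient_scope.

Section Span.
Variables (R : comNzRingType) (V : lmodType R).

Definition submod_span (S : V -> Prop) : {pred V} := fun v =>
  `[< exists2 s : seq (R * V), (forall p, p \in s -> S p.2)
                             & v = \sum_(p <- s) p.1 *: p.2 >].

Lemma submod_span_closed S : submod_closed (submod_span S).
Proof.
split=> [|a u v /asboolP[s sS ->] /asboolP[t tS ->]]; apply/asboolP.
  by exists [::]; rewrite ?big_nil.
exists ([seq (a * p.1, p.2) | p <- s] ++ t).
  move=> p; rewrite mem_cat => /orP[/mapP[q /sS qS ->] //|/tS //].
rewrite big_cat big_map /= scaler_sumr; congr (_ + _).
by apply: eq_bigr => p _; rewrite scalerA.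
Qed.

HB.instance Definition _ S :=
  GRing.isSubmodClosed.Build R V (submod_span S) (submod_span_closed S).

End Span.

Section ModuleQuotient.
(* V / <S> *)
Variables (R : comNzRingType) (V : lmodType R) (S : V -> Prop).

Definition modquot : Type := Quotient.quot (submod_span S).

HB.instance Definition _ := Choice.on modquot.
HB.instance Definition _ := EqQuotient.on modquot.
HB.instance Definition _ := GRing.Zmodule.on modquot.
HB.instance Definition _ := ZmodQuotient.on modquot.

Definition modquot_scale (a : R) : modquot -> modquot :=
  lift_op1 modquot ( *:%R a).

Lemma pi_modquot_eq (u v : V) :
  (\pi_modquot u == \pi_modquot v) = (u - v \in submod_span S).
Proof. by rewrite [LHS]piE. Qed.

Lemma pi_modquotZ a (v : V) :
  \pi_modquot (a *: v) = modquot_scale a (\pi_modquot v).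
Proof.
rewrite /modquot_scale; unlock; apply/eqP.
rewrite pi_modquot_eq -scalerBr rpredZ //.
by rewrite -pi_modquot_eq reprK.
Qed.

Lemma modquot_scaleA a b q :
  modquot_scale a (modquot_scale b q) = modquot_scale (a * b) q.
Proof. by elim/quotW: q => q; rewrite -!pi_modquotZ scalerA. Qed.

Lemma modquot_scale1 : left_id 1 modquot_scale.
Proof. by elim/quotW=> q; rewrite -!pi_modquotZ scale1r. Qed.

Lemma modquot_scaleDr : right_distributive modquot_scale +%R.
Proof.
move=> a; elim/quotW=> p; elim/quotW=> q.
by rewrite -!raddfD -!pi_modquotZ scalerDr raddfD.
Qed.

Lemma modquot_scaleDl q : {morph modquot_scale^~ q : a b / a + b}.
Proof.
by elim/quotW: q => q a b; rewrite -!pi_modquotZ scalerDl raddfD.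
Qed.

HB.instance Definition _ := GRing.Zmodule_isLmodule.Build R modquot
  modquot_scaleA modquot_scale1 modquot_scaleDr modquot_scaleDl.

Definition modpi (v : V) : modquot := \pi_modquot v.

Lemma modpi_linear : linear modpi.
Proof. by move=> a u v; rewrite /modpi raddfD /= pi_modquotZ. Qed.

HB.instance Definition _ := GRing.isLinear.Build R V modquot *:%R modpi
  modpi_linear.

End ModuleQuotient.

Section Ideals.
Variable R : comNzRingType.

Definition ideal_gen (S : R -> Prop) : {pred R} :=
  submod_span (S : R^o -> Prop).

Definition ideal_mul (I J : {pred R}) : {pred R} :=
  ideal_gen (fun a => exists u v, [/\ u \in I, v \in J & a = u * v]).

Fixpoint ideal_exp (I : {pred R}) (n : nat) : {pred R} :=
  if n is n'.+1 then ideal_mul I (ideal_exp I n') else predT.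

Definition ideal_smul (I : {pred R}) (V : lmodType R) : {pred V} :=
  submod_span (fun v => exists a w, a \in I /\ v = a *: w).

(* R/(a) as an R-module *)
Definition cyclic_mod (a : R) : lmodType R :=
  modquot (eq a : R^o -> Prop).

End Ideals.

Arguments ideal_smul {R} I V.

Section Homology.
Variables (R : comNzRingType) (U V W : lmodType R).
Variables (f : {linear U -> V}) (g : {linear V -> W}).

Definition ker_pred : {pred V} := fun v => g v == 0.

Lemma ker_submod_closed : submod_closed ker_pred.
Proof.
split=> [|a u v]; rewrite !unfold_in ?linear0 //.
by move=> /eqP gu /eqP gv; rewrite linearP gu gv scaler0 addr0.
Qed.

HB.instance Definition _ :=
  GRing.isSubmodClosed.Build R V ker_pred ker_submod_closed.

Record kermod := Kermod { kermod_val :> V; _ : kermod_val \in ker_pred }.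

HB.instance Definition _ := [isSub for kermod_val].
HB.instance Definition _ := [Choice of kermod by <:].
HB.instance Definition _ := [SubChoice_isSubLmodule of kermod by <:].

(* ker g / (im f \cap ker g); for a complex (g \o f = 0) this is ker g / im f *)
Definition homology : lmodType R :=
  modquot (fun z : kermod => exists u, f u = val z).

End Homology.

Section FreeModule.
Variables (R : comNzRingType) (T : choiceType).

Definition free_mod : lmodType R := {malg R[T]}.

Definition free_gen (t : T) : free_mod := monalg.mkmalgU t 1.

Section Lift.
Variables (V : lmodType R) (h : T -> V).

Definition free_lift (g : free_mod) : V :=
  \sum_(t <- enum_fset (monalg.msupp g)) monalg.mcoeff t g *: h t.

Lemma free_liftEw (g : free_mod) (d : {fset T}) :
  {subset monalg.msupp g <= d} ->
  free_lift g = \sum_(t <- enum_fset d) monalg.mcoeff t g *: h t.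
Proof.
move=> /fsubsetP sd; rewrite /free_lift.
apply: (big_fset_incl _ sd) => t _.
by rewrite -monalg.mcoeff_eq0 => /eqP ->; rewrite scale0r.
Qed.

Lemma free_lift_linear : linear free_lift.
Proof.
move=> a g g'.
pose d := fsetU (fsetU (monalg.msupp g) (monalg.msupp g'))
                       (monalg.msupp (a *: g + g')).
rewrite !(@free_liftEw _ d); first last.
- by move=> t; rewrite !inE => ->; rewrite ?orbT.
- by move=> t; rewrite !inE => ->; rewrite ?orbT.
- by move=> t; rewrite !inE => ->; rewrite ?orbT.
rewrite scaler_sumr -big_split /=; apply: eq_bigr => t _.
by rewrite monalg.mcoeffD monalg.mcoeffZ scalerDl scalerA.
Qed.

HB.instance Definition _ := GRing.isLinear.Build R free_mod V *:%R free_lift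
  free_lift_linear.

Lemma free_lift_gen t : free_lift (free_gen t) = h t.
Proof.
rewrite /free_lift monalg.msuppU oner_eq0 big_seq_fset1.
by rewrite monalg.mcoeffUU scale1r.
Qed.

End Lift.
End FreeModule.

Section Tensor.
Variable R : comNzRingType.

Section TensorDef.
Variables V W : lmodType R.

Let gen v w : free_mod R (V * W)%type := free_gen R (v, w).

Inductive tensor_rel : free_mod R (V * W)%type -> Prop :=
| TensorDl v v' w : tensor_rel (gen (v + v') w - gen v w - gen v' w)
| TensorDr v w w' : tensor_rel (gen v (w + w') - gen v w - gen v w')
| TensorZl a v w : tensor_rel (gen (a *: v) w - a *: gen v w)
| TensorZr a v w : tensor_rel (gen v (a *: w) - a *: gen v w).

Definition tensor : lmodType R := modquot tensor_rel.

Definition tens (v : V) (w : W) : tensor := modpi tensor_rel (gen v w).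

Lemma tensor_rel0 z : tensor_rel z -> modpi tensor_rel z = 0.
Proof.
move=> rz; apply/eqP; rewrite -(raddf0 (modpi tensor_rel)) pi_modquot_eq subr0.
apply/asboolP; exists [:: (1, z)]; last by rewrite big_seq1 scale1r.
by move=> p; rewrite inE => /eqP ->.
Qed.

Lemma tensDl v v' w : tens (v + v') w = tens v w + tens v' w.
Proof.
apply/eqP; rewrite -subr_eq0 opprD addrA /tens -!raddfB.
exact/eqP/tensor_rel0/TensorDl.
Qed.

Lemma tensDr v w w' : tens v (w + w') = tens v w + tens v w'.
Proof.
apply/eqP; rewrite -subr_eq0 opprD addrA /tens -!raddfB.
exact/eqP/tensor_rel0/TensorDr.
Qed.

Lemma tensZl a v w : tens (a *: v) w = a *: tens v w.
Proof.
apply/eqP; rewrite -subr_eq0 /tens -linearZ -raddfB.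
exact/eqP/tensor_rel0/TensorZl.
Qed.

Lemma tensZr a v w : tens v (a *: w) = a *: tens v w.
Proof.
apply/eqP; rewrite -subr_eq0 /tens -linearZ -raddfB.
exact/eqP/tensor_rel0/TensorZr.
Qed.

End TensorDef.

Section TensorMap.
Variables (V V' W : lmodType R) (f : {linear V -> V'}).

Let lift : {linear free_mod R (V * W)%type -> tensor V' W} :=
  free_lift (fun p => tens (f p.1) p.2).

(* f \otimes id_W; it does not depend on the representative (tensorl_pi) *)
Definition tensorl (t : tensor V W) : tensor V' W := lift (repr t).

Lemma tensorl_pi (u : free_mod R (V * W)%type) :
  tensorl (modpi (@tensor_rel V W) u) = lift u.
Proof.
suff lift0 z : z \in submod_span (@tensor_rel V W) -> lift z = 0.
  apply/eqP; rewrite -subr_eq0 -raddfB; apply/eqP/lift0.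
  by rewrite -pi_modquot_eq reprK.
case/asboolP=> s sS ->; rewrite linear_sum big_seq big1 // => p /sS.
rewrite linearZ /= => ps; suff -> : lift p.2 = 0 by rewrite scaler0.
case: ps => [v v' w|v w w'|a v w|a v w];
  rewrite !linearB ?linearZ /= ?scalerN ?free_lift_gen /=.
- by rewrite linearD tensDl addrAC addrK subrr.
- by rewrite tensDr addrAC addrK subrr.
- by rewrite linearZ /= tensZl subrr.
- by rewrite tensZr subrr.
Qed.

Lemma tensorl_linear : linear tensorl.
Proof.
move=> a t u; rewrite -[t]reprK -[u]reprK -/(modpi _ _) -/(modpi _ _) -linearP.
by rewrite !tensorl_pi [LHS]linearP.
Qed.

HB.instance Definition _ := GRing.isLinear.Build R (tensor V W) (tensor V' W)
  *:%R tensorl tensorl_linear.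

Lemma tensorl_tens v w : tensorl (tens v w) = tens (f v) w.
Proof. rewrite tensorl_pi; exact: free_lift_gen. Qed.

End TensorMap.
End Tensor.

Section Tor.
Variable R : comNzRingType.

Definition aug (V : lmodType R) : {linear free_mod R V -> V} :=
  free_lift (@idfun V).

Definition syz (V : lmodType R) : lmodType R := kermod (aug V).

Fixpoint iter_syz (V : lmodType R) (n : nat) : lmodType R :=
  if n is n'.+1 then syz (iter_syz V n') else V.

(* The canonical free resolution ... -> F_1 -> F_0 -> V -> 0: F_n is free on
   the elements of the n-th syzygy, and F_n+1 -> F_n factors as
   F_n+1 ->> iter_syz V n.+1 = ker (F_n -> iter_syz V n) >-> F_n. *)
Definition res (V : lmodType R) (n : nat) : lmodType R :=
  free_mod R (iter_syz V n).

Definition res_d (V : lmodType R) (n : nat) : {linear res V n.+1 -> res V n} :=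
  (val : syz (iter_syz V n) -> res V n) \o aug (iter_syz V n.+1).

Definition Tor (V W : lmodType R) (i : nat) : lmodType R :=
  if i is i'.+1 then
    homology (@tensorl R _ _ W (res_d V i'.+1)) (@tensorl R _ _ W (res_d V i'))
  else
    homology (@tensorl R _ _ W (res_d V 0))
             (\0 : tensor (res V 0) W -> tensor (res V 0) W).

Lemma aug_surj (V : lmodType R) (v : V) : exists g, aug V g = v.
Proof. by exists (free_gen R v); apply: free_lift_gen. Qed.

Lemma aug_syz (V : lmodType R) (g : free_mod R V) :
  aug V g = 0 <-> exists h, val (aug (syz V) h) = g.
Proof.
split=> [g0|[h <-]]; last exact/eqP/(valP (aug (syz V) h)).
have kg : g \in ker_pred (aug V) by rewrite unfold_in g0.
by have [h hE] := aug_surj (Kermod kg); exists h; rewrite hE.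
Qed.

Lemma res_exact0 (V : lmodType R) (g : res V 0) :
  aug V g = 0 <-> exists h, res_d V 0 h = g.
Proof. exact: aug_syz. Qed.

Lemma res_exact (V : lmodType R) n (g : res V n.+1) :
  res_d V n g = 0 <-> exists h, res_d V n.+1 h = g.
Proof.
rewrite -(aug_syz (V := iter_syz V n.+1)) /=.
by split=> [g0|->]; [apply: val_inj|]; rewrite ?linear0.
Qed.

End Tor.

Section Ring.
Variable K : fieldType.

(* the {mpoly K[2]} of mpoly; that notation is captured by monalg here *)
Local Notation Kxy := (mpoly.mpoly 2 K).

Let X : Kxy := 'X_(0 : 'I_2).
Let Y : Kxy := 'X_(1 : 'I_2).

Definition relR : {pred Kxy} :=
  ideal_gen (fun p => p = X * Y \/ p = X ^+ 2 - Y ^+ 3).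

Lemma relR_idealr_closed : idealr_closed relR.
Proof.
have [r0 rD] := submod_span_closed
  (fun p : Kxy^o => p = X * Y \/ p = X ^+ 2 - Y ^+ 3).
split=> //; apply/negP => /asboolP[s sS s1].
have ev0 p : p \in s -> meval (fun=> 0) (p.2 : Kxy) = 0.
  case/sS=> ->; first by rewrite rmorphM /= mevalXU mul0r.
  by rewrite rmorphB !rmorphXn /= !mevalXU !expr0n subrr.
have : meval (fun=> 0) (1 : Kxy) = 0.
  rewrite s1 rmorph_sum big_seq big1 //= => p /ev0 p0.
  by rewrite [meval _ _]rmorphM /= p0 mulr0.
by apply/eqP; rewrite meval1 oner_eq0.
Qed.

HB.instance Definition _ := isIdealr.Build Kxy relR relR_idealr_closed.

Definition ringR : comNzRingType := {ideal_quot relR}.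

Definition xR : ringR := \pi_({ideal_quot relR}) X.
Definition yR : ringR := \pi_({ideal_quot relR}) Y.

Definition maxR : {pred ringR} := ideal_gen (fun a => a = xR \/ a = yR).

Definition modM : lmodType ringR := cyclic_mod yR.
Definition modN : lmodType ringR := cyclic_mod (xR - yR).

End Ring.

Arguments maxR : clear implicits.

(* Main.v *)
Require Import Defs.
From HB Require Import structures.
From mathcomp Require Import all_boot all_order all_algebra.
From mathcomp Require Import ring_quotient generic_quotient boolp.
From mathcomp Require Import finmap monalg mpoly ring.

(** Put [c = x - y] and [d = x + y^2], so that [c d = 0] and [N = R/(c)].  In [R]
    the annihilator of [c] is [(d)] and that of [d] is [(c)], hence
    [... -> R -d-> R -c-> R] resolves [N], and [Tor_i(V, N)] vanishes for all
    [i >= 1] exactly when the 2-periodic complex [... V -c-> V -d-> V ...] is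
    exact.  This exactness holds for free modules and is inherited by the syzygy
    module of [V] from [V], so only [Tor_1] of the syzygies has to be treated,
    where tensoring with [N] is reduction modulo [c].  On [M = K[x]/(x^2)] both
    [c] and [d] act as [x], and the annihilator of [x] in [M] is [xM].  The
    annihilators in [R] are computed in the basis [1, x, y, y^2, y^3]. *)

Set Implicit Arguments.
Unset Strict Implicit.
Unset Printing Implicit Defensive.

Import GRing.Theory.
Local Open Scope ring_scope.
Local Open Scope quotient_scope.

Lemma regular_scaleE (R : comNzRingType) (a b : R) : a *: (b : R^o) = a * b.
Proof. by []. Qed.

(** * Spans, quotients and free modules *)

Section Span.
Variables (R : comNzRingType) (V : lmodType R).

Lemma submod_span_gen (S : V -> Prop) v : S v -> v \in submod_span S.
Proof.
move=> Sv; apply/asboolP; exists [:: (1, v)]; last by rewrite big_seq1 scale1r.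
by move=> p; rewrite inE => /eqP ->.
Qed.

Lemma submod_span_ind (S P : V -> Prop) :
    P 0 -> (forall a u v, P u -> P v -> P (a *: u + v)) ->
    (forall v, S v -> P v) ->
  forall v, v \in submod_span S -> P v.
Proof.
move=> P0 PD PS v /asboolP[s sS ->]; elim: s sS => [|p s IH] sS.
  by rewrite big_nil.
rewrite big_cons; apply: PD; first by apply/PS/sS; rewrite mem_head.
by apply: IH => q qs; apply: sS; rewrite inE qs orbT.
Qed.

Lemma modpi_eq0 (S : V -> Prop) v : (modpi S v == 0) = (v \in submod_span S).
Proof. by rewrite -(raddf0 (modpi S)) pi_modquot_eq subr0. Qed.

Lemma modpi_surj (S : V -> Prop) (q : modquot S) : exists v, modpi S v = q.
Proof. by exists (repr q); rewrite /modpi reprK. Qed.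

Lemma span_multiples (c : R) v :
  v \in submod_span (fun w : V => exists u, w = c *: u) -> exists u, v = c *: u.
Proof.
apply: (submod_span_ind (P := fun v => exists u, v = c *: u)) => // [|a _ _ [u ->] [w ->]].
  by exists 0; rewrite scaler0.
by exists (a *: u + w); rewrite scalerDr !scalerA mulrC.
Qed.

End Span.

Section FreeModule.
Variables (R : comNzRingType) (T : choiceType).

Lemma free_modE (f : free_mod R T) :
  f = \sum_(t <- enum_fset (monalg.msupp f)) monalg.mcoeff t f *: free_gen R t.
Proof.
rewrite {1}(monalg.monalgE f); apply: eq_bigr => t _; apply/monalg.malgP => k.
by rewrite monalg.mcoeffZ !monalg.mcoeffU; case: eqP => _; rewrite ?mulr1 ?mulr0.
Qed.

End FreeModule.

(** * Bilinear maps out of the tensor product *)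

Section TensorLift.
Variables (R : comNzRingType) (V W U : lmodType R).

(** The linear extension of [h] to the free module on pairs kills the tensor relations, hence
    everything that becomes zero in the tensor product. *)
Lemma bilinear_tens_eq0 (h : V -> W -> U) v w :
    tens v w = 0 -> (forall w, linear (h^~ w)) -> (forall v, linear (h v)) ->
  h v w = 0.
Proof.
move=> vw0 hl hr.
have hDl x y w' : h (x + y) w' = h x w' + h y w'.
  by have := hl w' 1 x y; rewrite !scale1r.
have hDr v' x y : h v' (x + y) = h v' x + h v' y.
  by have := hr v' 1 x y; rewrite !scale1r.
have h0l w' : h 0 w' = 0.
  by apply: (addrI (h 0 w')); rewrite -hDl !addr0.
have h0r v' : h v' 0 = 0.
  by apply: (addrI (h v' 0)); rewrite -hDr !addr0.
have hZl a x w' : h (a *: x) w' = a *: h x w'.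
  by have := hl w' a x 0; rewrite h0l !addr0.
have hZr a v' x : h v' (a *: x) = a *: h v' x.
  by have := hr v' a x 0; rewrite h0r !addr0.
pose L : {linear free_mod R (V * W)%type -> U} := free_lift (fun p => h p.1 p.2).
have LE v' w' : L (free_gen R (v', w')) = h v' w' by exact: free_lift_gen.
have LB u z : L (u - z) = L u - L z by rewrite linearB.
have LZ a u : L (a *: u) = a *: L u by rewrite linearZ.
have L0 : L 0 = 0 by rewrite linear0.
have LD u z : L (u + z) = L u + L z by rewrite linearD.
(* From here on only linearity of [L] and its values on generators matter. *)
clearbody L.
move/eqP: vw0; rewrite modpi_eq0 -LE.
apply: (submod_span_ind (P := fun z => L z = 0)) => //.
  by move=> a u z u0 z0; rewrite LD LZ u0 z0 scaler0 addr0.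
move=> _ [x x' y|x y y'|a x y|a x y].
- by rewrite !LB !LE hDl addrAC addrK subrr.
- by rewrite !LB !LE hDr addrAC addrK subrr.
- by rewrite LB LZ !LE hZl subrr.
- by rewrite LB LZ !LE hZr subrr.
Qed.

Lemma tens0r (v : V) : tens v (0 : W) = 0.
Proof. by rewrite -(scale0r (0 : W)) tensZr scale0r. Qed.

Lemma tens0l (w : W) : tens (0 : V) w = 0.
Proof. by rewrite -(scale0r (0 : V)) tensZl scale0r. Qed.

End TensorLift.

(** * Cyclic modules and reduction modulo [c] *)

Section CyclicModule.
Variables (R : comNzRingType) (c : R).

Definition cyclic_one : cyclic_mod c := modpi (eq c : R^o -> Prop) (1 : R^o).

Lemma cyclic_modP (q : cyclic_mod c) : exists a, q = a *: cyclic_one.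
Proof.
have [a <-] := modpi_surj q; exists a.
by rewrite /cyclic_one -linearZ /= [_ *: _]mulr1.
Qed.

Lemma scale_cyclic_one_eq0 a : a *: cyclic_one = 0 <-> exists b, a = c * b.
Proof.
rewrite /cyclic_one -linearZ; split=> [/eqP|[b ->]].
  rewrite modpi_eq0 [_ *: _]mulr1.
  apply: (submod_span_ind (V := R^o) (P := fun a : R => exists b, a = c * b))
      => [|r _ _ [u ->] [v ->]|_ <-]; last by exists 1; rewrite mulr1.
    by exists 0; rewrite mulr0.
  by exists (r * u + v); rewrite mulrDr mulrCA.
apply/eqP; rewrite modpi_eq0 [_ *: _]mulr1 mulrC.
by rewrite [b * c](_ : _ = b *: (c : R^o)) // rpredZ // submod_span_gen.
Qed.

Section TensorCyclic.
Variable V : lmodType R.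

(** Scalars move to the left factor, so a sum of pure tensors collapses to a single one. *)
Lemma tensor_cyclicP (t : tensor V (cyclic_mod c)) :
  exists v, t = tens v cyclic_one.
Proof.
have [z <-] := modpi_surj t.
rewrite [z]free_modE linear_sum /=.
elim/big_rec: _ => [|[v q] _ _ [w ->]].
  by exists 0; rewrite tens0l.
have [a ->] := cyclic_modP q; set e := monalg.mcoeff _ _.
exists (e *: (a *: v) + w).
by rewrite tensDl !tensZl -tensZr linearZ.
Qed.

(** Detected by the bilinear map to [V/cV] that sends [v] and the class of [a] to the class of
    [a v]. *)
Lemma tens_cyclic_one_eq0 (v : V) :
  tens v cyclic_one = 0 -> exists u, v = c *: u.
Proof.
pose cV := fun w : V => exists u, w = c *: u.
pose h w (q : cyclic_mod c) : modquot cV := modpi cV ((repr q : R) *: w).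
(* Two representatives differ by a multiple of [c], which [V/cV] does not see. *)
have hE w a : h w (a *: cyclic_one) = modpi cV (a *: w).
  have [b bE]: exists b, repr (a *: cyclic_one) - a = c * b.
    apply/scale_cyclic_one_eq0; rewrite scalerBl.
    set q := a *: _; apply/eqP; rewrite subr_eq0 -[X in _ == X]reprK.
    by rewrite /cyclic_one -linearZ /= regular_scaleE mulr1.
  apply/eqP; rewrite -subr_eq0 -linearB /= -scalerBl bE modpi_eq0.
  by apply: submod_span_gen; exists (b *: w); rewrite scalerA.
move=> /(bilinear_tens_eq0 (h := h)) h0; apply/span_multiples.
rewrite -modpi_eq0 -/cV -[v in modpi _ v]scale1r -hE scale1r h0 //=.
  by move=> q a u w; rewrite /h scalerDr !scalerA mulrC -scalerA linearD linearZ.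
move=> w a q q'; have [b ->] := cyclic_modP q; have [b' ->] := cyclic_modP q'.
by rewrite scalerA -scalerDl !hE scalerDl linearD -scalerA linearZ.
Qed.

End TensorCyclic.
End CyclicModule.

(* [(0 :_V c) <= d V]; when [(d)] is the annihilator of [c] in [R], this is the
   vanishing of [Tor_1(V, R/(c))]. *)
Definition ann_sub (R : comNzRingType) (c d : R) (V : lmodType R) :=
  forall v : V, c *: v = 0 -> exists w, v = d *: w.

(** * Periodic exactness, syzygies and vanishing of Tor *)

Section AnnihilatorExactness.
Variables (R : comNzRingType).

Lemma ann_sub_free (c d : R) (T : choiceType) :
  ann_sub c d R^o -> ann_sub c d (free_mod R T).
Proof.
move=> cd f cf; rewrite [f]free_modE.
elim/big_rec: _ => [|t _ _ [w ->]]; first by exists 0; rewrite scaler0.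
have [|b ->] := cd (monalg.mcoeff t f : R^o).
  rewrite [LHS](_ : _ = monalg.mcoeff t (c *: f)); last by rewrite monalg.mcoeffZ.
  by rewrite cf monalg.mcoeff0.
by exists (b *: free_gen R t + w); rewrite scalerDr scalerA.
Qed.

(** A chase in [0 -> syz V -> F -> V -> 0]: write [s = d f] in [F], correct [f] by a multiple of [c]
    to land in the syzygy, and use [c d = 0]. The roles of [c] and [d] swap on [V], so both
    inclusions are carried along the iteration below. *)
Lemma ann_sub_syz (c d : R) (V : lmodType R) :
    c * d = 0 -> ann_sub c d R^o -> ann_sub d c V ->
  ann_sub c d (syz V).
Proof.
move=> cd0 cdR dcV s cs0.
have [|f sE] := @ann_sub_free c d V cdR (val s).
  by rewrite -linearZ cs0.
have [|v vE] := dcV (aug V f).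
  by rewrite -linearZ -sE; apply/eqP/(valP s).
have [g gE] := aug_surj v.
have k : f - c *: g \in ker_pred (aug V).
  by rewrite unfold_in linearB linearZ /= gE -vE subrr.
exists (Kermod k); apply: val_inj; rewrite linearZ /= scalerBr scalerA.
by rewrite mulrC cd0 scale0r subr0.
Qed.

Lemma ann_sub_iter_syz (c d : R) (V : lmodType R) :
    c * d = 0 -> ann_sub c d R^o -> ann_sub d c R^o ->
    ann_sub c d V -> ann_sub d c V ->
  forall n, ann_sub c d (iter_syz V n) /\ ann_sub d c (iter_syz V n).
Proof.
move=> cd0 cdR dcR cdV dcV; elim=> [|n [cdn dcn]] //=.
by split; apply: ann_sub_syz; rewrite // mulrC.
Qed.

Lemma homology_eq0 (U V W : lmodType R) (f : {linear U -> V}) (g : {linear V -> W}) :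
    (forall v, g v = 0 -> exists u, f u = v) ->
  forall t : homology f g, t = 0.
Proof.
move=> fg t; have [z <-] := modpi_surj t; apply/eqP; rewrite modpi_eq0.
by apply: submod_span_gen; apply: fg; apply/eqP/(valP z).
Qed.

Lemma Tor_cyclic_eq0 (c d : R) (V : lmodType R) i :
    c * d = 0 -> ann_sub c d (iter_syz V i) ->
  forall t : Tor V (cyclic_mod c) i.+1, t = 0.
Proof.
move=> cd0 cdV; apply: homology_eq0 => z.
have [f ->] := tensor_cyclicP z.
rewrite -[LHS]/(tensorl (res_d V i) (tens f _)) tensorl_tens.
move=> /tens_cyclic_one_eq0[g gE].
(* The cycle condition reads [res_d f = c g]; exactness on the [i]-th syzygy gives [aug g = d v]. *)
have [|v vE] := cdV (aug _ g).
  by rewrite -linearZ -gE; apply/eqP/(valP (aug (iter_syz V i.+1) f)).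
have [h hE] := aug_surj v.
have k : g - d *: h \in ker_pred (aug (iter_syz V i)).
  by rewrite unfold_in linearB linearZ /= hE -vE subrr.
have [f' f'E] := aug_surj (Kermod k : iter_syz V i.+1).
(* The differential of [f - c f'] is [c g - c (g - d h) = c d h = 0]. *)
have /res_exact[u uE] : res_d V i (f - c *: f') = 0.
  rewrite linearB linearZ gE /= f'E /= -scalerBr opprB addrCA subrr addr0.
  by rewrite scalerA cd0 scale0r.
(* Since [c] kills [R/(c)], the tensors of [f - c f'] and of [f] with [1] agree. *)
exists (tens u (cyclic_one c)).
rewrite [LHS]tensorl_tens uE tensDl -scaleNr tensZl -tensZr.
have -> : - c *: cyclic_one c = 0.
  by apply/scale_cyclic_one_eq0; exists (-1); rewrite mulrN1.
by rewrite tens0r addr0.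
Qed.

End AnnihilatorExactness.

Lemma ideal_mul_mem (R : comNzRingType) (I J : {pred R}) u v :
  u \in I -> v \in J -> u * v \in ideal_mul I J.
Proof. by move=> uI vJ; apply: (submod_span_gen (V := R^o)); exists u, v. Qed.

(** * The basis [1, x, y, y^2, y^3] of [R] *)

Section NormalForm.
Variable K : fieldType.
Local Notation Kxy := (mpoly.mpoly 2 K).
Local Notation R := (ringR K).
Local Notation x := (xR K).
Local Notation y := (yR K).

Definition projR (p : Kxy) : R := \pi_({ideal_quot @relR K}) p.

Lemma projR_is_zmod_morphism : zmod_morphism projR.
Proof. by move=> p q; rewrite /projR rmorphB. Qed.
Lemma projR_is_monoid_morphism : monoid_morphism projR.
Proof. by split=> [|p q]; rewrite /projR ?rmorph1 ?rmorphM. Qed.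
HB.instance Definition _ :=
  GRing.isZmodMorphism.Build Kxy R projR projR_is_zmod_morphism.
HB.instance Definition _ :=
  GRing.isMonoidMorphism.Build Kxy R projR projR_is_monoid_morphism.

Lemma projR_eq0 p : (projR p == 0) = (p \in @relR K).
Proof. by rewrite -[p in RHS]subr0 Quotient.idealrBE -(rmorph0 projR). Qed.

Lemma xR_yR : x * y = 0.
Proof.
rewrite /xR /yR -!/(projR _) -rmorphM; apply/eqP; rewrite projR_eq0.
by apply: (@submod_span_gen Kxy Kxy^o); left.
Qed.

Lemma xR2_yR3 : x ^+ 2 = y ^+ 3.
Proof.
apply/eqP; rewrite -subr_eq0 /xR /yR -!/(projR _) -!rmorphXn -rmorphB projR_eq0.
by apply: (@submod_span_gen Kxy Kxy^o); right.
Qed.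

Lemma yR4 : y ^+ 4 = 0.
Proof. by rewrite (exprSr _ 3) -xR2_yR3 expr2 -mulrA xR_yR mulr0. Qed.

Lemma projR_surj a : exists p, projR p = a.
Proof. by exists (repr a); rewrite /projR reprK. Qed.

Definition scalR (a : K) : R := projR (mpolyC 2 a).

Lemma scalR_is_zmod_morphism : zmod_morphism scalR.
Proof. by move=> a b; rewrite /scalR !rmorphB. Qed.
HB.instance Definition _ :=
  GRing.isZmodMorphism.Build K R scalR scalR_is_zmod_morphism.

Definition nform a0 a1 a2 a3 a4 : R :=
  scalR a0 + scalR a1 * x + scalR a2 * y + scalR a3 * y ^+ 2 + scalR a4 * y ^+ 3.

Lemma nform_exists a : exists a0 a1 a2 a3 a4, a = nform a0 a1 a2 a3 a4.
Proof.
have [p <-] := projR_surj a; rewrite [p]mpolyE rmorph_sum /=.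
elim/big_rec: _ => [|m _ _ [b0 [b1 [b2 [b3 [b4 ->]]]]]].
  by exists 0, 0, 0, 0, 0; rewrite /nform raddf0 !mul0r !addr0.
suff [a0 [a1 [a2 [a3 [a4 ->]]]]] : exists a0 a1 a2 a3 a4,
    projR (p@_m *: 'X_[m]) = nform a0 a1 a2 a3 a4.
  exists (a0 + b0), (a1 + b1), (a2 + b2), (a3 + b3), (a4 + b4).
  by rewrite /nform !raddfD /=; ring.
rewrite -mul_mpolyC mpolyXE_id !big_ord_recl big_ord0 mulr1 !rmorphM !rmorphXn /=.
set c := p@_m; rewrite -/(scalR c).
rewrite (_ : projR 'X_ord0 = x) //.
rewrite (_ : projR 'X_(lift ord0 ord0) = y); last first.
  by congr (projR 'X_(_)); apply: val_inj.
move: (m _) (m _) => j i.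
have xy := xR_yR; have xx := xR2_yR3.
have y4 := yR4.
have xyn u v : x ^+ u.+1 * y ^+ v.+1 = 0.
  by rewrite exprSr exprS mulrA -(mulrA (x ^+ u)) xy mulr0 mul0r.
(* Here [i] and [j] are the exponents of [x] and [y]. Outside the basis, mixed monomials and [y^4]
   vanish, [x^2] is [y^3], and [x^3 = x y^3 = 0]. *)
case: i => [|i].
  case: j => [|[|[|[|j]]]].
  - by exists c, 0, 0, 0, 0; rewrite /nform raddf0; ring.
  - by exists 0, 0, c, 0, 0; rewrite /nform raddf0; ring.
  - by exists 0, 0, 0, c, 0; rewrite /nform raddf0; ring.
  - by exists 0, 0, 0, 0, c; rewrite /nform raddf0; ring.
  - by exists 0, 0, 0, 0, 0; rewrite /nform raddf0 (exprD _ 4 j) y4; ring.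
case: j => [|j]; last by exists 0, 0, 0, 0, 0; rewrite /nform raddf0 xyn; ring.
case: i => [|[|i]].
- by exists 0, c, 0, 0, 0; rewrite /nform raddf0; ring.
- by exists 0, 0, 0, 0, c; rewrite /nform raddf0 xx; ring.
exists 0, 0, 0, 0, 0; rewrite /nform raddf0.
by rewrite (exprD x 3 i) (exprS x 2) xx (xyn 0 2); ring.
Qed.


(** At [a = 0] this shows that the two specialisations in [socle] have the same constant term. *)
Lemma horner_mmap (h : 'I_2 -> {poly K}) p a :
  (mmap polyC h p).[a] = meval (fun i => (h i).[a]) p.
Proof.
rewrite /meval /mmap horner_sum; apply: eq_bigr => m _.
rewrite hornerM hornerC /mmap1 horner_prod; congr (_ * _).
by apply: eq_bigr => i _; rewrite horner_exp.
Qed.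

(* The sum of the coefficients of [y^3] and [x^2], read off from [p(0, t)] and
   [p(t, 0)]: it descends to the linear form on [R] that generates its dual. *)
Definition socle (p : Kxy) : K :=
  (mmap polyC (fun i => if i == 0 then 0 else 'X) p)`_3 +
  (mmap polyC (fun i => if i == 0 then 'X else 0) p)`_2.

(** Both specialisations kill [b x y]; on [b (x^2 - y^3)] they contribute [-b(0,0)] and [b(0,0)]. *)
Lemma socle_relR p : p \in @relR K -> socle p = 0.
Proof.
move=> pR; rewrite -[p]mul1r.
(* [socle] is not linear over the polynomial ring, so the induction needs all multiples. *)
suff: forall b, socle (b * p) = 0 by apply.
move: p pR.
apply: (submod_span_ind (V := Kxy^o) (P := fun p : Kxy => forall b, socle (b * p) = 0)).
- by move=> b; rewrite mulr0 /socle !rmorph0 !coef0 addr0.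
- move=> a u v u0 v0 b; have := u0 (b * a); have := v0 b.
  rewrite /socle mulrDr (mulrA b) !rmorphD /= !coefD addrACA => -> ->.
  by rewrite addr0.
move=> p [->|->] b; rewrite /socle !(rmorphM, rmorphB, rmorphXn) /= !mmapX !mmap1U /=.
  by rewrite !(mul0r, mulr0) !coef0 addr0.
rewrite !mul0r sub0r subr0 mulrN coefN !mulrA !coefMX /= -!horner_coef0 !horner_mmap.
have h0 : (fun i : 'I_2 => (if i == 0 then 0 else 'X : {poly K}).[0]) =1
          (fun i : 'I_2 => (if i == 0 then 'X else 0 : {poly K}).[0]).
  by move=> i; case: eqP => _; rewrite hornerX hornerC.
by rewrite (meval_eq _ h0) addNr.
Qed.

Lemma nform_coef4_eq0 a0 a1 a2 a3 a4 : nform a0 a1 a2 a3 a4 = 0 -> a4 = 0.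
Proof.
pose X : Kxy := 'X_(0 : 'I_2); pose Y : Kxy := 'X_(1 : 'I_2).
pose C := mpolyC 2 (R := K).
have -> : nform a0 a1 a2 a3 a4 =
    projR (C a0 + C a1 * X + C a2 * Y + C a3 * Y ^+ 2 + C a4 * Y ^+ 3).
  by rewrite !(rmorphD, rmorphM).
move/eqP; rewrite projR_eq0 => /socle_relR.
rewrite /socle !(rmorphD, rmorphM) /= !mmapC !mmapX !mmap1U /= -expr2 -exprS.
rewrite !(expr0n, mulr0, addr0) /= !coefD !coefCM !coefXn !coefX !coefC /=.
by rewrite !(mulr0, add0r, addr0, mulr1).
Qed.

(* Multiplying by [y^3], [x], [y^2] and [y] moves the other coefficients to [y^3]. *)
Lemma nform_eq0 a0 a1 a2 a3 a4 : nform a0 a1 a2 a3 a4 = 0 ->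
  [/\ a0 = 0, a1 = 0, a2 = 0, a3 = 0 & a4 = 0].
Proof.
have xy := xR_yR; have xx := xR2_yR3; have y4 := yR4.
move=> a_0; split; last exact: nform_coef4_eq0 a_0.
- apply: (@nform_coef4_eq0 0 0 0 0); rewrite -(mul0r (y ^+ 3)) -a_0 /nform !raddf0.
  by ring: xy y4.
- apply: (@nform_coef4_eq0 0 a0 0 0); rewrite -(mul0r x) -a_0 /nform !raddf0.
  by ring: xy xx.
- apply: (@nform_coef4_eq0 0 0 0 a0); rewrite -(mul0r (y ^+ 2)) -a_0 /nform !raddf0.
  by ring: xy y4.
- apply: (@nform_coef4_eq0 0 0 a0 a2); rewrite -(mul0r y) -a_0 /nform !raddf0.
  by ring: xy y4.
Qed.

(** * Annihilators in [R] and in [M] *)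

Lemma mul_xBy_xDy2 : (x - y) * (x + y ^+ 2) = 0.
Proof. by have xy := xR_yR; have xx := xR2_yR3; ring: xy xx. Qed.

Lemma ann_xBy : ann_sub (x - y) (x + y ^+ 2) R^o.
Proof.
have xy := xR_yR; have xx := xR2_yR3; have y4 := yR4.
move=> a; have [a0 [a1 [a2 [a3 [a4 ->]]]]] := nform_exists a => ca0.
(* These are the coordinates of [(x - y) a]. *)
have /nform_eq0[_ a0E _ /eqP a2E /eqP a13E] : nform 0 a0 (- a0) (- a2) (a1 - a3) = 0.
  rewrite -[RHS]ca0 regular_scaleE /nform !(raddf0, raddfN, raddfD) /=.
  by ring: xy xx y4.
move: a2E a13E; rewrite oppr_eq0 subr_eq0 => /eqP a2E /eqP <-.
(* What remains is [a1 (x + y^2) + a4 y^3], and [y^3 = (x + y^2) y]. *)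
exists (scalR a1 + scalR a4 * y); rewrite regular_scaleE /nform a0E a2E !raddf0.
by ring: xy.
Qed.

Lemma ann_xDy2 : ann_sub (x + y ^+ 2) (x - y) R^o.
Proof.
have xy := xR_yR; have xx := xR2_yR3; have y4 := yR4.
move=> a; have [a0 [a1 [a2 [a3 [a4 ->]]]]] := nform_exists a => da0.
have /nform_eq0[_ a0E _ _ /eqP] : nform 0 a0 0 a0 (a1 + a2) = 0.
  rewrite -[RHS]da0 regular_scaleE /nform !(raddf0, raddfD) /=.
  by ring: xy xx y4.
rewrite addrC addr_eq0 => /eqP ->.
(* What remains is [a1 (x - y) + a3 y^2 + a4 y^3], and [(x - y) y = -y^2]. *)
exists (scalR a1 - scalR a3 * y - scalR a4 * y ^+ 2).
rewrite regular_scaleE /nform a0E raddf0 raddfN /=.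
by ring: xy.
Qed.

(** The [x]-coordinate of [x a - y b] is the constant term of [a]. In [M] this says that the
    annihilator of [x] is [xM]. *)
Lemma xR_mul_in_yR a b : x * a = y * b -> exists e f, a = x * e + y * f.
Proof.
have xy := xR_yR; have xx := xR2_yR3; have y4 := yR4.
have [a0 [a1 [a2 [a3 [a4 ->]]]]] := nform_exists a.
have [b0 [b1 [b2 [b3 [b4 ->]]]]] := nform_exists b => /eqP; rewrite -subr_eq0 => /eqP ab.
have /nform_eq0[_ a0E _ _ _] : nform 0 a0 (- b0) (- b2) (a1 - b3) = 0.
  rewrite -ab /nform !(raddf0, raddfN, raddfD) /=.
  by ring: xy xx y4.
exists (scalR a1), (scalR a2 + scalR a3 * y + scalR a4 * y ^+ 2).
by rewrite /nform a0E raddf0; ring.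
Qed.

(** Multiples of [y] act as zero on [M], so both elements act as [x]. Free [r] and [s] cover [x - y]
    and [x + y^2] in either order. *)
Lemma ann_modM r s : ann_sub (x + y * r) (x + y * s) (modM K).
Proof.
move=> v; have [a ->] := cyclic_modP v.
rewrite scalerA => /scale_cyclic_one_eq0[b ab].
have [|e [f ->]] := @xR_mul_in_yR a (b - r * a).
  by rewrite mulrBr -ab; ring.
exists (e *: cyclic_one y); apply/eqP; rewrite scalerA -subr_eq0 -scalerBl.
by apply/eqP/scale_cyclic_one_eq0; exists (f - s * e); ring.
Qed.

(** * Powers of the maximal ideal *)

Lemma ideal_gen_coords (S : R -> Prop) :
    (forall u, S u -> exists e f, u = x * e + y * f) ->
  forall u, u \in ideal_gen S -> exists e f, u = x * e + y * f.
Proof.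
move=> Sxy; apply: (submod_span_ind (V := R^o)) => // [|r _ _ [e [f ->]] [e' [f' ->]]].
  by exists 0, 0; rewrite !mulr0 addr0.
by exists (r * e + e'), (r * f + f'); rewrite regular_scaleE; ring.
Qed.

Lemma maxR_coords u : u \in maxR K -> exists e f, u = x * e + y * f.
Proof.
apply: ideal_gen_coords => _ [->|->]; first by exists 1, 0; rewrite mulr1 mulr0 addr0.
by exists 0, 1; rewrite mulr1 mulr0 add0r.
Qed.

(** As [x y = 0], the square of the maximal ideal is generated by [x^2] and [y^2]. *)
Lemma maxR2_smul_eq0 (V : lmodType R) :
    (forall v : V, x ^+ 2 *: v = 0) -> (forall v : V, y ^+ 2 *: v = 0) ->
  ideal_smul (ideal_exp (maxR K) 2) V =i pred1 0.
Proof.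
move=> xxV yyV w; rewrite !inE; apply/idP/eqP => [|->]; last exact: rpred0.
apply: (submod_span_ind (P := fun w => w = 0)) => // [a _ _ -> ->|_ [a [{}w [aI ->]]]].
  by rewrite scaler0 addr0.
move: a aI w; apply: (submod_span_ind (V := R^o) (P := fun a => forall w : V, a *: w = 0)).
- by move=> w; rewrite scale0r.
- move=> r a b aV bV w; rewrite regular_scaleE scalerDl bV -scalerA aV scaler0.
  by rewrite addr0.
move=> _ [u [v [/maxR_coords[e [f ->]] vI ->]]] w.
(* [v] lies in the first power, which by definition is the product of the ideal with [R]. *)
have [e' [f' ->]] : exists e' f', v = x * e' + y * f'.
  apply: (ideal_gen_coords _ vI) => _ [c [d [/maxR_coords[c' [d' ->]] _ ->]]].
  by exists (c' * d), (d' * d); ring.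
have -> : (x * e + y * f) * (x * e' + y * f') = x ^+ 2 * (e * e') + y ^+ 2 * (f * f').
  by have xy := xR_yR; ring: xy.
by rewrite scalerDl -(scalerA (x ^+ 2)) xxV -(scalerA (y ^+ 2)) yyV addr0.
Qed.

Lemma maxR3_neq0 : ~ ideal_exp (maxR K) 3 =i pred1 0.
Proof.
have yM : y \in maxR K by apply: (submod_span_gen (V := R^o)); right.
(* The witness is the basis element [y^3]; the factor [1] comes from the zeroth power. *)
move=> /(_ (y * (y * (y * 1)))); rewrite [LHS]ideal_mul_mem ?ideal_mul_mem //.
rewrite inE => /esym/eqP y3.
have /nform_eq0[_ _ _ _] : nform 0 0 0 0 1 = 0.
  by rewrite -[RHS]y3 /nform raddf0 /scalR !rmorph1; ring.
by apply/eqP; rewrite oner_eq0.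
Qed.

End NormalForm.

Theorem theorem0p3 (K : fieldType) :
  [/\ ideal_smul (ideal_exp (maxR K) 2) (modM K) =i pred1 0,
      ideal_smul (ideal_exp (maxR K) 2) (modN K) =i pred1 0,
      forall i : nat, (1 <= i)%N -> forall t : Tor (modM K) (modN K) i, t = 0
    & ~ (ideal_exp (maxR K) 3 =i pred1 0)].
Proof.
split; last exact: maxR3_neq0.
- apply: maxR2_smul_eq0 => v; have [a ->] := cyclic_modP v; rewrite scalerA.
    apply/scale_cyclic_one_eq0; exists (yR K ^+ 2 * a).
    by rewrite xR2_yR3 exprS mulrA.
  by apply/scale_cyclic_one_eq0; exists (yR K * a); rewrite mulrA.
(* In [R], [x^2 = (x - y) x] and [y^2 = (x - y) (-y)]. *)
- have xy := xR_yR K.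
  apply: maxR2_smul_eq0 => v; have [a ->] := cyclic_modP v; rewrite scalerA.
    by apply/scale_cyclic_one_eq0; exists (xR K * a); ring: xy.
  by apply/scale_cyclic_one_eq0; exists (- yR K * a); ring: xy.
case=> // i _; apply: (Tor_cyclic_eq0 (@mul_xBy_xDy2 K)).
apply: (proj1 (ann_sub_iter_syz (@mul_xBy_xDy2 K) (@ann_xBy K) (@ann_xDy2 K) _ _ i)).
  by rewrite -mulrN1 expr2; apply: ann_modM.
by rewrite -mulrN1 expr2; apply: ann_modM.
Qed.
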